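(* Suppose $f,g:(0,\infty)\to(0,\infty)$ are continuous functions satisfying $$\lim_{t\to\infty}\frac{\log f(t)}{t}=\infty\quad\text{and}\quad \lim_{t\to\infty}\frac{\log g(t)}{t}=\infty.$$ Let $h:(0,1)\to(0,\infty)$ be a continuous function satisfying $\lim_{r\to0^+}h(r)=\infty$. Then there exist $C^2$ positive solutions $u(x)$ and $v(x)$ of the system $$0\le -\Delta u\le f(v),\qquad 0\le -\Delta v\le g(u)$$ in $B_1(0)\setminus\{0\}\subset\mathbb{R}^2$ such that $$u(x)\ne O(h(|x|))\quad\text{as }x\to0\qquad\text{and}\qquad v(x)\neq O(h(|x|))\quad\text{as }x\to 0.$$
   Context: $B_r(x_0)$ denotes the open ball of radius $r$ centered at $x_0$. The notation $u(x)\ne O(h(|x|))$ as $x\to 0$ means that the statement ''$u(x)=O(h(|x|))$ as $x\to0$'' is false. *)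

(* Defs.v *)
From Stdlib Require Import Reals.
From Coquelicot Require Import Coquelicot.

Open Scope R_scope.

Definition enorm (x1 x2 : R) : R := sqrt (x1 ^ 2 + x2 ^ 2).

Definition open_disk (a1 a2 r : R) (x1 x2 : R) : Prop :=
  enorm (x1 - a1) (x2 - a2) < r.

Definition punctured_unit_disk (x1 x2 : R) : Prop :=
  open_disk 0 0 1 x1 x2 /\ ~ (x1 = 0 /\ x2 = 0).

(* [ex_diff_n u 2 x1 x2] asks for existence and continuity at (x1, x2) of all
   iterated partial derivatives of order at most 2, in both orders of
   differentiation. Required at every point of an open set [D], this is
   membership in C^2(D); values of [u] outside [D] play no role. *)
Definition C2_on (D : R -> R -> Prop) (u : R -> R -> R) : Prop :=
  forall x1 x2 : R, D x1 x2 -> ex_diff_n u 2 x1 x2.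

Definition laplacian (u : R -> R -> R) (x1 x2 : R) : R :=
  partial_derive 2 0 u x1 x2 + partial_derive 0 2 u x1 x2.

Definition bigO_at_origin (u w : R -> R -> R) : Prop :=
  exists C delta : R, 0 < delta /\
    forall x1 x2 : R, 0 < enorm x1 x2 < delta ->
      Rabs (u x1 x2) <= C * Rabs (w x1 x2).

(* Main.v *)
Require Import Defs.
From Stdlib Require Import Reals Lra Lia IndefiniteDescription.
From Coquelicot Require Import Coquelicot.

Open Scope R_scope.

(** A single function [u] serves for both components: with [v = u], the system
    reduces to [0 <= - laplacian u <= F u] for [F = min (f, g)], and the growth
    hypotheses say that [F t > exp (K t)] for every [K] and all large [t].

    The function is a superposition of mollified logarithmic potentials
    [w_n = e_n (c - ln s_n)], [s_n (x, y) = (x - a_n)^2 + y^2 + q_n], whose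
    centres [(a_n, 0)] tend to the origin and whose weights [e_n] sum to [1];
    one dyadic sequence is used both for [a_n] and for [e_n].  Everything
    rests on the freedom to take [q_n > 0] as small as we please.

    - At its centre [w_n] equals [e_n (c - ln q_n)], which exceeds any
      prescribed value, in particular [(n + 1) h (a_n)], once [q_n] is small.
      All potentials being nonnegative, [u] is at least as large there, so it
      is not [O(h)].

    - The density of [w_n] is [- laplacian w_n = 4 e_n q_n / s_n^2], and it
      never exceeds [e_n F(u)] (lemma [pot_density_le]).  With [K = 2 / e_n],
      let [T] be such that [F t > exp (K t)] for [t > T].  Where [u > T], we get
      [F u > exp (K w_n) = exp (2 c) / s_n^2], which dominates the density.
      Where [u <= T], also [w_n <= T], so [s_n] is bounded below by a constant
      independent of [q_n]; the density is then [O(q_n)], while [F u >= 1].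
      Summing over [n] gives [- laplacian u <= F u].

    - Away from the origin the [s_n] have a common positive lower bound, so
      the series and its formal derivatives up to order two are dominated by
      multiples of the weights; the Weierstrass M-test then makes [u] of
      class C^2 and allows its Laplacian to be computed termwise
      (lemma [Series2_C2]). *)

(** * Termwise differentiation of dominated series *)

Lemma ex_series_dominated (a M : nat -> R) :
  (forall n, Rabs (a n) <= M n) -> ex_series M -> ex_series a.
Proof. intros H; apply (ex_series_le (K := R_AbsRing) (V := R_CompleteNormedModule)); exact H. Qed.

Lemma Series_tail_le (a M : nat -> R) (N : nat) :
  (forall n, Rabs (a n) <= M n) -> ex_series M ->
  Rabs (sum_n a N - Series a) <= Series M - sum_n M N.
Proof.
  intros H HM.
  assert (Ha := ex_series_dominated _ _ H HM).
  rewrite (Series_incr_n a (S N)) by (auto; lia).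
  rewrite (Series_incr_n M (S N)) by (auto; lia).
  rewrite !sum_n_Reals; simpl pred.
  replace (_ - _) with (- Series (fun k => a (S N + k)%nat)) by ring.
  rewrite Rabs_Ropp.
  replace (_ - _) with (Series (fun k => M (S N + k)%nat)) by ring.
  assert (HT : ex_series (fun k => M (S N + k)%nat)) by (apply ex_series_incr_n; exact HM).
  assert (HTa : ex_series (fun k => Rabs (a (S N + k)%nat))).
  { apply ex_series_dominated with (2 := HT); intros n; rewrite Rabs_Rabsolu; apply H. }
  eapply Rle_trans; [apply Series_Rabs; exact HTa|].
  apply Series_le; [|exact HT].
  intros n; split; [apply Rabs_pos|apply H].
Qed.

Lemma eventually_tail_lt (M : nat -> R) (eps : posreal) :
  ex_series M -> eventually (fun N => Series M - sum_n M N < eps).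
Proof.
  intros HM.
  assert (H := Series_correct M HM).
  apply (is_lim_seq_spec (sum_n M) (Series M)) in H.
  destruct (H eps) as [N HN].
  exists N; intros n Hn; specialize (HN n Hn).
  apply Rabs_def2 in HN; lra.
Qed.

(** The Weierstrass M-test. *)
Lemma CVU_dom_series (phi : nat -> R -> R) (M : nat -> R) (D : R -> Prop) :
  ex_series M -> (forall n x, D x -> Rabs (phi n x) <= M n) ->
  CVU_dom (fun N x => sum_n (fun n => phi n x) N) D.
Proof.
  intros HM H eps.
  generalize (eventually_tail_lt M eps HM); apply filter_imp.
  intros N HN x Hx.
  eapply Rle_lt_trans; [|exact HN].
  apply (Series_tail_le (fun n => phi n x)); auto.
Qed.

Lemma is_derive_Series (phi psi : nat -> R -> R) (M1 M2 : nat -> R) (x0 : R) :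
  ex_series M1 -> ex_series M2 ->
  locally x0 (fun x => forall n,
    is_derive (phi n) x (psi n x) /\ continuity_pt (psi n) x /\
    Rabs (phi n x) <= M1 n /\ Rabs (psi n x) <= M2 n) ->
  is_derive (fun x => Series (fun n => phi n x)) x0
    (Series (fun n => psi n x0)).
Proof.
  intros H1 H2 [d Hd].
  set (D := fun x => x0 - d < x < x0 + d).
  assert (HD : forall x, D x -> forall n,
    is_derive (phi n) x (psi n x) /\ continuity_pt (psi n) x /\
    Rabs (phi n x) <= M1 n /\ Rabs (psi n x) <= M2 n).
  { intros x [Hx1 Hx2]; apply Hd.
    change (Rabs (x - x0) < d); apply Rabs_def1; lra. }
  assert (D0 : D x0) by (destruct d as [d dp]; unfold D; simpl; lra).
  assert (oD : open D) by (apply open_and; [apply open_gt|apply open_lt]).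
  assert (Hder : forall N x, D x -> is_derive (fun y => sum_n (fun n => phi n y) N) x
                   (sum_n (fun n => psi n x) N)).
  { intros N x Hx; apply (is_derive_sum_n phi N x (fun n => psi n x)).
    intros k _; apply (HD x Hx k). }
  assert (HDer : forall N x, D x -> Derive (fun y => sum_n (fun n => phi n y) N) x =
                   sum_n (fun n => psi n x) N).
  { intros N x Hx; apply is_derive_unique, Hder, Hx. }
  assert (K : is_derive (fun x => Series (fun n => phi n x)) x0
     (real (Lim_seq (fun N => Derive (fun y => sum_n (fun n => phi n y) N) x0)))).
  { apply (CVU_Derive (fun N y => sum_n (fun n => phi n y) N) D); auto.
    - intros a b x [Ha1 Ha2] [Hb1 Hb2] Hx; unfold D; lra.
    - apply CVU_dom_series with M1; auto; intros n x Hx; apply (HD x Hx n).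
    - intros N x Hx; eexists; apply Hder, Hx.
    - intros N x Hx.
      apply continuity_pt_ext_loc with (f := fun y => sum_n (fun n => psi n y) N).
      + generalize (oD x Hx); apply filter_imp; intros y Hy; symmetry; auto.
      + apply continuity_pt_ext with (f := fun y => sum_f_R0 (fun n => psi n y) N).
        { intros y; symmetry; apply sum_n_Reals. }
        induction N as [|N IH]; simpl.
        * apply (HD x Hx 0%nat).
        * apply continuity_pt_plus; [exact IH|apply (HD x Hx (S N))].
    - intros eps.
      assert (C := CVU_dom_series psi M2 D H2
        (fun n x Hx => proj2 (proj2 (proj2 (HD x Hx n)))) eps).
      revert C; apply filter_imp; intros N HN x Hx.
      rewrite (HDer N x Hx).
      rewrite (Lim_seq_ext _ (fun N => sum_n (fun n => psi n x) N)); auto. }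
  rewrite (Lim_seq_ext _ (fun N => sum_n (fun n => psi n x0) N)) in K; auto.
Qed.

(** * Series of functions of two variables *)

Definition open_2d (D : R -> R -> Prop) : Prop :=
  forall x y, D x y -> locally_2d D x y.

(** The hypothesis of the M-test in local form: the majorant may depend on the
    base point, which is what series of functions that blow up at a boundary
    point (here, the origin) require. *)
Definition dominated_family (D : R -> R -> Prop) (phi : nat -> R -> R -> R) : Prop :=
  forall x y, D x y ->
    (forall n, continuity_2d_pt (phi n) x y) /\
    exists M : nat -> R, ex_series M /\
      locally_2d (fun x' y' => forall n, Rabs (phi n x' y') <= M n) x y.

Definition has_partials (D : R -> R -> Prop) (u ux uy : R -> R -> R) : Prop :=
  forall x y, D x y ->
    is_derive (fun z => u z y) x (ux x y) /\
    is_derive (fun z => u x z) y (uy x y).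

Definition Series2 (phi : nat -> R -> R -> R) (x y : R) : R :=
  Series (fun n => phi n x y).

Lemma continuity_Series2 (D : R -> R -> Prop) (phi : nat -> R -> R -> R) (x y : R) :
  dominated_family D phi -> D x y -> continuity_2d_pt (Series2 phi) x y.
Proof.
  intros HN Hxy eps.
  destruct (HN x y Hxy) as [Hc [M [HM Hb]]].
  (* An eps/3 argument: the two tails and the finite sum each get a third. *)
  assert (e3 : 0 < eps / 3) by (destruct eps; simpl; lra).
  destruct (eventually_tail_lt M (mkposreal _ e3) HM) as [N HNN].
  specialize (HNN N (Nat.le_refl N)); simpl in HNN.
  assert (Hs : continuity_2d_pt (fun x y => sum_n (fun n => phi n x y) N) x y).
  { apply continuity_2d_pt_ext with (f := fun x y => sum_f_R0 (fun n => phi n x y) N).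
    { intros; symmetry; apply sum_n_Reals. }
    clear HNN; induction N as [|N IH]; simpl.
    - apply Hc.
    - apply continuity_2d_pt_plus; [exact IH|apply Hc]. }
  specialize (Hs (mkposreal _ e3)); simpl in Hs.
  assert (H0 := locally_2d_singleton _ _ _ Hb).
  generalize (locally_2d_and _ _ _ _ Hs Hb).
  apply locally_2d_impl; apply locally_2d_forall.
  intros a b [Ha Hab].
  assert (T1 := Series_tail_le (fun n => phi n x y) M N H0 HM).
  assert (T2 := Series_tail_le (fun n => phi n a b) M N Hab HM).
  unfold Series2.
  apply Rabs_def2 in Ha.
  apply Rabs_le_between in T1; apply Rabs_le_between in T2.
  apply Rabs_def1; lra.
Qed.

Lemma continuity_2d_pt_1d (phi : R -> R -> R) (x y : R) :
  continuity_2d_pt phi x y ->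
  continuity_pt (fun z => phi z y) x /\ continuity_pt (fun z => phi x z) y.
Proof.
  intros H; split; apply continuity_pt_locally; intros eps.
  - apply (locally_2d_1d_const_y _ _ _ (H eps)).
  - apply (locally_2d_1d_const_x _ _ _ (H eps)).
Qed.

Lemma has_partials_Series2 (D : R -> R -> Prop) (phi phix phiy : nat -> R -> R -> R) :
  open_2d D -> dominated_family D phi -> dominated_family D phix -> dominated_family D phiy ->
  (forall n, has_partials D (phi n) (phix n) (phiy n)) ->
  has_partials D (Series2 phi) (Series2 phix) (Series2 phiy).
Proof.
  intros oD N Nx Ny P x y Hxy.
  destruct (N x y Hxy) as [_ [M [HM Hb]]].
  destruct (Nx x y Hxy) as [_ [Mx [HMx Hbx]]].
  destruct (Ny x y Hxy) as [_ [My [HMy Hby]]].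
  split.
  - apply (is_derive_Series (fun n z => phi n z y) (fun n z => phix n z y) M Mx x HM HMx).
    generalize (locally_2d_1d_const_y _ _ _
      (locally_2d_and _ _ _ _ (oD x y Hxy) (locally_2d_and _ _ _ _ Hb Hbx))).
    apply filter_imp; intros z [Hz [H1 H2]] n.
    split; [|split; [|split]]; auto.
    + apply (P n z y Hz).
    + apply (continuity_2d_pt_1d (phix n) z y (proj1 (Nx z y Hz) n)).
  - apply (is_derive_Series (fun n z => phi n x z) (fun n z => phiy n x z) M My y HM HMy).
    generalize (locally_2d_1d_const_x _ _ _
      (locally_2d_and _ _ _ _ (oD x y Hxy) (locally_2d_and _ _ _ _ Hb Hby))).
    apply filter_imp; intros z [Hz [H1 H2]] n.
    split; [|split; [|split]]; auto.
    + apply (P n x z Hz).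
    + apply (continuity_2d_pt_1d (phiy n) x z (proj1 (Ny x z Hz) n)).
Qed.

(** Unlike the recursive clause of [ex_diff_n], which speaks of [Derive], this
    takes explicit partial derivatives; they agree with [Derive] near
    each point of an open set, which is all that [ex_diff_n] sees. *)
Lemma ex_diff_n_S (D : R -> R -> Prop) (u ux uy : R -> R -> R) (k : nat) :
  open_2d D -> has_partials D u ux uy ->
  (forall x y, D x y -> continuity_2d_pt u x y) ->
  (forall x y, D x y -> ex_diff_n ux k x y) ->
  (forall x y, D x y -> ex_diff_n uy k x y) ->
  forall x y, D x y -> ex_diff_n u (S k) x y.
Proof.
  intros oD P C Hx Hy x y Hxy.
  destruct (P x y Hxy) as [Px Py].
  split; [|split; [|split; [|split]]].
  - auto.
  - eexists; exact Px.
  - eexists; exact Py.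
  - apply ex_diff_n_ext_loc with (2 := Hx x y Hxy).
    generalize (oD x y Hxy); apply locally_2d_impl; apply locally_2d_forall.
    intros a b Hab; symmetry; apply is_derive_unique, (P a b Hab).
  - apply ex_diff_n_ext_loc with (2 := Hy x y Hxy).
    generalize (oD x y Hxy); apply locally_2d_impl; apply locally_2d_forall.
    intros a b Hab; symmetry; apply is_derive_unique, (P a b Hab).
Qed.

Lemma laplacian_has_partials (D : R -> R -> Prop) (u ux uy uxx uxy uyx uyy : R -> R -> R) :
  open_2d D -> has_partials D u ux uy ->
  has_partials D ux uxx uxy -> has_partials D uy uyx uyy ->
  forall x y, D x y -> laplacian u x y = uxx x y + uyy x y.
Proof.
  intros oD P Px Py x y Hxy.
  unfold laplacian, partial_derive; simpl Derive_n.
  f_equal.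
  - rewrite (Derive_ext_loc _ (fun z => ux z y)).
    + apply is_derive_unique, (Px x y Hxy).
    + generalize (locally_2d_1d_const_y _ _ _ (oD x y Hxy)).
      apply filter_imp; intros z Hz; apply is_derive_unique, (P z y Hz).
  - rewrite (Derive_ext_loc _ (fun z => uy x z)).
    + apply is_derive_unique, (Py x y Hxy).
    + generalize (locally_2d_1d_const_x _ _ _ (oD x y Hxy)).
      apply filter_imp; intros z Hz; apply is_derive_unique, (P x z Hz).
Qed.

Lemma Series2_C2 (D : R -> R -> Prop)
  (phi phix phiy phixx phixy phiyx phiyy : nat -> R -> R -> R) :
  open_2d D ->
  dominated_family D phi -> dominated_family D phix -> dominated_family D phiy ->
  dominated_family D phixx -> dominated_family D phixy ->
  dominated_family D phiyx -> dominated_family D phiyy ->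
  (forall n, has_partials D (phi n) (phix n) (phiy n)) ->
  (forall n, has_partials D (phix n) (phixx n) (phixy n)) ->
  (forall n, has_partials D (phiy n) (phiyx n) (phiyy n)) ->
  C2_on D (Series2 phi) /\
  forall x y, D x y ->
    laplacian (Series2 phi) x y = Series2 phixx x y + Series2 phiyy x y.
Proof.
  intros oD N Nx Ny Nxx Nxy Nyx Nyy P Px Py.
  assert (Q := has_partials_Series2 D _ _ _ oD N Nx Ny P).
  assert (Qx := has_partials_Series2 D _ _ _ oD Nx Nxx Nxy Px).
  assert (Qy := has_partials_Series2 D _ _ _ oD Ny Nyx Nyy Py).
  assert (C0 : forall psi, dominated_family D psi ->
    forall x y, D x y -> ex_diff_n (Series2 psi) 0 x y).
  { intros psi Hpsi x y Hxy; split; [|exact I].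
    apply continuity_Series2 with D; auto. }
  split.
  - refine (ex_diff_n_S D _ _ _ 1 oD Q _ _ _).
    + intros x y; apply continuity_Series2; exact N.
    + refine (ex_diff_n_S D _ _ _ 0 oD Qx _ _ _); auto.
      intros x y; apply continuity_Series2; exact Nx.
    + refine (ex_diff_n_S D _ _ _ 0 oD Qy _ _ _); auto.
      intros x y; apply continuity_Series2; exact Ny.
  - apply (laplacian_has_partials D _ _ _ _ _ _ _ oD Q Qx Qy).
Qed.


(** * Mollified logarithmic potentials *)

(** The term [q] mollifies: it keeps the logarithm of [sq_dist] smooth at the
    centre. *)
Definition sq_dist (a q x y : R) : R := (x - a) ^ 2 + y ^ 2 + q.

Definition pot (e a c q x y : R) : R := e * (c - ln (sq_dist a q x y)).

(** The derivatives are written as polynomials in [x - a], [y] and the inverse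
    of [sq_dist], so that continuity and bounds follow factor by factor. *)
Definition pot_x (e a q x y : R) : R := e * (- 2 * ((x - a) * / sq_dist a q x y)).
Definition pot_y (e a q x y : R) : R := e * (- 2 * (y * / sq_dist a q x y)).
Definition pot_xx (e a q x y : R) : R :=
  e * (- 2 * / sq_dist a q x y + 4 * ((x - a) * / sq_dist a q x y * ((x - a) * / sq_dist a q x y))).
Definition pot_xy (e a q x y : R) : R :=
  e * (4 * ((x - a) * / sq_dist a q x y * (y * / sq_dist a q x y))).
Definition pot_yy (e a q x y : R) : R :=
  e * (- 2 * / sq_dist a q x y + 4 * (y * / sq_dist a q x y * (y * / sq_dist a q x y))).

Lemma sq_dist_ge (a q x y : R) : q <= sq_dist a q x y.
Proof. unfold sq_dist; assert (H1 := pow2_ge_0 (x - a)); assert (H2 := pow2_ge_0 y); lra. Qed.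

Lemma has_partials_pot (D : R -> R -> Prop) (e a c q : R) : 0 < q ->
  has_partials D (pot e a c q) (pot_x e a q) (pot_y e a q).
Proof.
  intros Hq x y _; assert (H := sq_dist_ge a q x y).
  unfold pot, pot_x, pot_y, sq_dist in *.
  split; auto_derive; try lra; field; simpl in *; lra.
Qed.

Lemma has_partials_pot_x (D : R -> R -> Prop) (e a q : R) : 0 < q ->
  has_partials D (pot_x e a q) (pot_xx e a q) (pot_xy e a q).
Proof.
  intros Hq x y _; assert (H := sq_dist_ge a q x y).
  unfold pot_x, pot_xx, pot_xy, sq_dist in *.
  split; auto_derive; try lra; field; simpl in *; lra.
Qed.

Lemma has_partials_pot_y (D : R -> R -> Prop) (e a q : R) : 0 < q ->
  has_partials D (pot_y e a q) (pot_xy e a q) (pot_yy e a q).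
Proof.
  intros Hq x y _; assert (H := sq_dist_ge a q x y).
  unfold pot_y, pot_xy, pot_yy, sq_dist in *.
  split; auto_derive; try lra; field; simpl in *; lra.
Qed.

Lemma pot_neg_laplacian (e a q x y : R) : 0 < q ->
  - (pot_xx e a q x y + pot_yy e a q x y) = 4 * e * q * / sq_dist a q x y ^ 2.
Proof.
  intros Hq; assert (H := sq_dist_ge a q x y).
  unfold pot_xx, pot_yy, sq_dist in *; field; lra.
Qed.

Ltac continuity_2d :=
  repeat first
   [ apply continuity_2d_pt_const | apply continuity_2d_pt_id1 | apply continuity_2d_pt_id2
   | apply continuity_2d_pt_minus | apply continuity_2d_pt_plus | apply continuity_2d_pt_mult ].

Lemma continuity_sq_dist (a q x y : R) : continuity_2d_pt (sq_dist a q) x y.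
Proof.
  apply continuity_2d_pt_ext with (f := fun x y => (x - a) * (x - a) + y * y + q).
  { intros; unfold sq_dist; ring. }
  continuity_2d.
Qed.

Lemma continuity_pot_all (e a c q x y : R) : 0 < q ->
  continuity_2d_pt (pot e a c q) x y /\ continuity_2d_pt (pot_x e a q) x y /\
  continuity_2d_pt (pot_y e a q) x y /\ continuity_2d_pt (pot_xx e a q) x y /\
  continuity_2d_pt (pot_xy e a q) x y /\ continuity_2d_pt (pot_yy e a q) x y.
Proof.
  intros Hq; assert (H := sq_dist_ge a q x y).
  assert (C := continuity_sq_dist a q x y).
  assert (CI : continuity_2d_pt (fun x y => / sq_dist a q x y) x y).
  { apply continuity_2d_pt_inv; [exact C|lra]. }
  split; [|repeat split; unfold pot_x, pot_y, pot_xx, pot_xy, pot_yy;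
    repeat first [exact CI | progress continuity_2d]].
  unfold pot; continuity_2d.
  apply (continuity_1d_2d_pt_comp ln); [|exact C].
  apply derivable_continuous_pt; eexists; apply derivable_pt_lim_ln; lra.
Qed.

Lemma Rabs_mult_le (a b A B : R) : Rabs a <= A -> Rabs b <= B -> Rabs (a * b) <= A * B.
Proof.
  intros; rewrite Rabs_mult; apply Rmult_le_compat; auto using Rabs_pos.
Qed.

(** All bounds are multiples of the weight [e] by a constant that depends on
    [c] and the lower bound [m], but not on [a] or [q]; a summable sequence of
    weights therefore dominates the series whatever the [q]'s are. *)
Lemma pot_bounds (e a c q x y m : R) : 0 <= e -> 0 < m ->
  Rabs (x - a) <= 2 -> Rabs y <= 2 -> m <= sq_dist a q x y <= 4 ->
  Rabs (pot e a c q x y) <= e * (Rabs c + Rabs (ln m) + 4) /\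
  Rabs (pot_x e a q x y) <= e * (2 * (2 * / m)) /\
  Rabs (pot_y e a q x y) <= e * (2 * (2 * / m)) /\
  Rabs (pot_xx e a q x y) <= e * (2 * / m + 4 * (2 * / m * (2 * / m))) /\
  Rabs (pot_xy e a q x y) <= e * (4 * (2 * / m * (2 * / m))) /\
  Rabs (pot_yy e a q x y) <= e * (2 * / m + 4 * (2 * / m * (2 * / m))).
Proof.
  intros He Hm Hx Hy [Hs1 Hs2].
  unfold pot, pot_x, pot_y, pot_xx, pot_xy, pot_yy.
  set (s := sq_dist a q x y) in *.
  assert (Hi : Rabs (/ s) <= / m).
  { rewrite Rabs_pos_eq by (apply Rlt_le, Rinv_0_lt_compat; lra).
    apply Rinv_le_contravar; lra. }
  assert (A2 : Rabs (-2) <= 2) by (rewrite Rabs_left; lra).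
  assert (A4 : Rabs 4 <= 4) by (rewrite Rabs_pos_eq; lra).
  assert (Ae : Rabs e <= e) by (rewrite Rabs_pos_eq; lra).
  split.
  - apply Rabs_mult_le; auto.
    assert (L1 : ln m <= ln s) by (apply ln_le; lra).
    assert (L2 : ln s <= 4).
    { apply Rle_trans with (ln (exp 4)); [apply ln_le; [lra|]|rewrite ln_exp; lra].
      assert (E := exp_ineq1 4 ltac:(lra)); lra. }
    unfold Rabs; repeat destruct Rcase_abs; lra.
  - repeat split; repeat first
      [ apply Rabs_mult_le; auto
      | eapply Rle_trans; [apply Rabs_triang|]; apply Rplus_le_compat ].
Qed.

(** * Superposition along a dyadic sequence of centres *)

(** Serves both as the sequence of weights, because its sum is [1], and as the
    sequence of centres, because it tends to [0] inside the unit disk. *)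
Definition dyadic (n : nat) : R := (/ 2) ^ S n.

Lemma dyadic_bounds (n : nat) : 0 < dyadic n <= / 2.
Proof.
  unfold dyadic; simpl.
  assert (H : 0 < (/ 2) ^ n <= 1); [|lra].
  split; [apply pow_lt; lra|].
  rewrite <- (pow1 n); apply pow_incr; lra.
Qed.

Lemma is_series_dyadic : is_series dyadic 1.
Proof.
  assert (H := is_series_geom (/ 2) ltac:(rewrite Rabs_pos_eq; lra)).
  apply (is_series_scal (K := R_AbsRing) (V := R_NormedModule) (/ 2)) in H.
  replace 1 with (scal (/ 2) (/ (1 - / 2))) by (compute; field).
  exact H.
Qed.

Lemma is_series_dyadic_mult (k : R) : is_series (fun n => dyadic n * k) k.
Proof.
  assert (H := is_series_scal_r k _ _ is_series_dyadic).
  rewrite Rmult_1_l in H; exact H.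
Qed.

Lemma dyadic_lim (eps : R) : 0 < eps -> eventually (fun n => dyadic n < eps).
Proof.
  intros He.
  assert (H := ex_series_lim_0 dyadic (ex_intro _ _ is_series_dyadic)).
  apply (is_lim_seq_spec dyadic 0) in H.
  destruct (H (mkposreal _ He)) as [N HN]; exists N; intros n Hn.
  specialize (HN n Hn); simpl in HN; apply Rabs_def2 in HN; lra.
Qed.

Lemma finite_lower_bound (q : nat -> R) (N : nat) : (forall n, 0 < q n) ->
  exists m, 0 < m /\ forall n, (n < N)%nat -> m <= q n.
Proof.
  intros Hq; induction N as [|N [m [Hm IH]]].
  - exists 1; split; [lra|lia].
  - exists (Rmin m (q N)); split; [apply Rmin_glb_lt; auto|].
    intros n Hn; destruct (Nat.eq_dec n N) as [->|].
    + apply Rmin_r.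
    + eapply Rle_trans; [apply Rmin_l|apply IH; lia].
Qed.

Lemma punctured_unit_disk_iff (x y : R) :
  punctured_unit_disk x y <-> 0 < x ^ 2 + y ^ 2 < 1.
Proof.
  unfold punctured_unit_disk, open_disk, enorm.
  rewrite !Rminus_0_r.
  assert (H1 := pow2_ge_0 x); assert (H2 := pow2_ge_0 y).
  split.
  - intros [H H']; split.
    + destruct (Req_dec x 0) as [->|Hx].
      * destruct (Req_dec y 0) as [->|Hy]; [tauto|].
        assert (0 < y ^ 2) by (apply pow2_gt_0; auto); lra.
      * assert (0 < x ^ 2) by (apply pow2_gt_0; auto); lra.
    + apply sqrt_lt_0_alt; rewrite sqrt_1; exact H.
  - intros [H H']; split.
    + rewrite <- sqrt_1; apply sqrt_lt_1_alt; lra.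
    + intros [-> ->]; lra.
Qed.

Lemma locally_annulus (x y : R) : punctured_unit_disk x y ->
  locally_2d (fun x' y' => (x ^ 2 + y ^ 2) / 2 < x' ^ 2 + y' ^ 2 < 1) x y.
Proof.
  rewrite punctured_unit_disk_iff; intros [H1 H2].
  assert (C : continuity_2d_pt (fun x y => x ^ 2 + y ^ 2) x y).
  { apply continuity_2d_pt_ext with (f := fun x y => x * x + y * y).
    { intros; ring. }
    continuity_2d. }
  assert (He : 0 < Rmin ((x ^ 2 + y ^ 2) / 2) (1 - (x ^ 2 + y ^ 2))) by (apply Rmin_glb_lt; lra).
  generalize (C (mkposreal _ He)); apply locally_2d_impl; apply locally_2d_forall.
  intros a b Hab; cbn [pos] in Hab; cbv beta in Hab; apply Rabs_def2 in Hab.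
  assert (M1 := Rmin_l ((x ^ 2 + y ^ 2) / 2) (1 - (x ^ 2 + y ^ 2))).
  assert (M2 := Rmin_r ((x ^ 2 + y ^ 2) / 2) (1 - (x ^ 2 + y ^ 2))).
  lra.
Qed.

Lemma open_punctured_unit_disk : open_2d punctured_unit_disk.
Proof.
  intros x y Hxy; generalize (locally_annulus x y Hxy).
  apply locally_2d_impl; apply locally_2d_forall.
  apply punctured_unit_disk_iff in Hxy.
  intros a b Hab; apply punctured_unit_disk_iff; lra.
Qed.

Lemma disk_geometry (a q x y : R) : 0 < a <= / 2 -> 0 < q <= / 4 -> x ^ 2 + y ^ 2 < 1 ->
  Rabs (x - a) <= 2 /\ Rabs y <= 2 /\ sq_dist a q x y <= 4.
Proof.
  intros Ha Hq H.
  assert (Hx : Rabs x <= 1) by (apply Rabs_le; nra).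
  assert (Hy : Rabs y <= 1) by (apply Rabs_le; nra).
  apply Rabs_le_between in Hx; apply Rabs_le_between in Hy.
  unfold sq_dist; repeat split; try apply Rabs_le; try lra; nra.
Qed.

(** Near a point other than the origin, all but finitely many centres stay at a
    definite distance; the remaining finitely many terms are at least [q n]. *)
Lemma sq_dist_locally_bounded_below (q : nat -> R) (x y : R) :
  (forall n, 0 < q n) -> punctured_unit_disk x y ->
  exists m, 0 < m /\
    locally_2d (fun x' y' => forall n, m <= sq_dist (dyadic n) (q n) x' y') x y.
Proof.
  intros Hq Hxy.
  assert (Hann := locally_annulus x y Hxy).
  apply punctured_unit_disk_iff in Hxy.
  set (rho := x ^ 2 + y ^ 2) in *.
  destruct (dyadic_lim (rho / 8) ltac:(lra)) as [N HN].
  destruct (finite_lower_bound q N Hq) as [m [Hm Hmq]].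
  exists (Rmin m (rho / 8)); split; [apply Rmin_glb_lt; lra|].
  revert Hann; apply locally_2d_impl; apply locally_2d_forall.
  intros a b Hab n.
  destruct (Nat.lt_ge_cases n N) as [Hn|Hn].
  - eapply Rle_trans; [apply Rmin_l|].
    eapply Rle_trans; [apply (Hmq n Hn)|apply sq_dist_ge].
  - eapply Rle_trans; [apply Rmin_r|].
    specialize (HN n Hn); assert (Hd := dyadic_bounds n); specialize (Hq n).
    unfold sq_dist.
    (* Expanding this square gives (a - d)^2 >= a^2 / 2 - d^2. *)
    assert (0 <= (a - 2 * dyadic n) ^ 2) by apply pow2_ge_0.
    nra.
Qed.

Lemma dominated_family_of_weighted_bound (q : nat -> R) (B : R -> R)
  (phi : nat -> R -> R -> R) :
  (forall n, 0 < q n <= / 4) ->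
  (forall n x y, continuity_2d_pt (phi n) x y) ->
  (forall m n x y, 0 < m -> Rabs (x - dyadic n) <= 2 -> Rabs y <= 2 ->
     m <= sq_dist (dyadic n) (q n) x y <= 4 ->
     Rabs (phi n x y) <= dyadic n * B m) ->
  dominated_family punctured_unit_disk phi.
Proof.
  intros Hq Hc Hb x y Hxy; split; [intros; apply Hc|].
  destruct (sq_dist_locally_bounded_below q x y (fun n => proj1 (Hq n)) Hxy)
    as [m [Hm Hloc]].
  exists (fun n => dyadic n * B m); split.
  - eexists; apply is_series_dyadic_mult.
  - generalize (locally_2d_and _ _ _ _ (locally_annulus x y Hxy) Hloc).
    apply locally_2d_impl; apply locally_2d_forall.
    intros a b [Hab Hs] n.
    destruct (disk_geometry (dyadic n) (q n) a b (dyadic_bounds n) (Hq n) (proj2 Hab))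
      as [G1 [G2 G3]].
    apply Hb; auto.
Qed.

Lemma pot_series_C2 (c : R) (q : nat -> R) : (forall n, 0 < q n <= / 4) ->
  C2_on punctured_unit_disk (Series2 (fun n => pot (dyadic n) (dyadic n) c (q n))) /\
  forall x y, punctured_unit_disk x y ->
    ex_series (fun n => pot (dyadic n) (dyadic n) c (q n) x y) /\
    is_series (fun n => 4 * dyadic n * q n * / sq_dist (dyadic n) (q n) x y ^ 2)
      (- laplacian (Series2 (fun n => pot (dyadic n) (dyadic n) c (q n))) x y).
Proof.
  intros Hq.
  assert (NF := fun B phi => dominated_family_of_weighted_bound q B phi Hq).
  assert (HC := fun n x y => continuity_pot_all (dyadic n) (dyadic n) c (q n) x y (proj1 (Hq n))).
  assert (HB := fun m n x y => pot_bounds (dyadic n) (dyadic n) c (q n) x y m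
     (Rlt_le _ _ (proj1 (dyadic_bounds n)))).
  set (w := fun n => pot (dyadic n) (dyadic n) c (q n)) in *.
  set (wx := fun n => pot_x (dyadic n) (dyadic n) (q n)).
  set (wy := fun n => pot_y (dyadic n) (dyadic n) (q n)).
  set (wxx := fun n => pot_xx (dyadic n) (dyadic n) (q n)).
  set (wxy := fun n => pot_xy (dyadic n) (dyadic n) (q n)).
  set (wyy := fun n => pot_yy (dyadic n) (dyadic n) (q n)).
  assert (N0 : dominated_family punctured_unit_disk w).
  { apply (NF (fun m => Rabs c + Rabs (ln m) + 4)); [intros; apply HC|intros; apply HB; auto]. }
  assert (Nx : dominated_family punctured_unit_disk wx).
  { apply (NF (fun m => 2 * (2 * / m))); [intros; apply HC|intros; apply HB; auto]. }
  assert (Ny : dominated_family punctured_unit_disk wy).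
  { apply (NF (fun m => 2 * (2 * / m))); [intros; apply HC|intros; apply HB; auto]. }
  assert (Nxx : dominated_family punctured_unit_disk wxx).
  { apply (NF (fun m => 2 * / m + 4 * (2 * / m * (2 * / m))));
      [intros; apply HC|intros; apply HB; auto]. }
  assert (Nxy : dominated_family punctured_unit_disk wxy).
  { apply (NF (fun m => 4 * (2 * / m * (2 * / m))));
      [intros; apply HC|intros; apply HB; auto]. }
  assert (Nyy : dominated_family punctured_unit_disk wyy).
  { apply (NF (fun m => 2 * / m + 4 * (2 * / m * (2 * / m))));
      [intros; apply HC|intros; apply HB; auto]. }
  destruct (Series2_C2 punctured_unit_disk w wx wy wxx wxy wxy wyy) as [HC2 HL];
    auto using open_punctured_unit_disk.
  { intros n; apply has_partials_pot, Hq. }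
  { intros n; apply has_partials_pot_x, Hq. }
  { intros n; apply has_partials_pot_y, Hq. }
  split; [exact HC2|].
  assert (EX : forall phi x y, dominated_family punctured_unit_disk phi -> punctured_unit_disk x y ->
    ex_series (fun n => phi n x y)).
  { intros phi x y Hphi Hxy; destruct (Hphi x y Hxy) as [_ [M [HM Hb]]].
    apply ex_series_dominated with (2 := HM); apply (locally_2d_singleton _ _ _ Hb). }
  intros x y Hxy; split; [exact (EX w x y N0 Hxy)|].
  rewrite (HL x y Hxy).
  apply is_series_ext with (fun n => opp (plus (wxx n x y) (wyy n x y))).
  { intros n; apply pot_neg_laplacian, Hq. }
  apply (is_series_opp (K := R_AbsRing) (V := R_NormedModule)).
  apply (is_series_plus (K := R_AbsRing) (V := R_NormedModule));
    apply Series_correct; [exact (EX wxx x y Nxx Hxy)|exact (EX wyy x y Nyy Hxy)].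
Qed.

(** * Choice of the mollification parameters *)

Lemma term_le_Series (a : nat -> R) (n : nat) :
  (forall k, 0 <= a k) -> ex_series a -> a n <= Series a.
Proof.
  intros Ha He.
  assert (T := Series_tail_le a a n (fun k => Req_le _ _ (Rabs_pos_eq _ (Ha k))) He).
  assert (P := Rabs_pos (sum_n a n - Series a)).
  apply Rle_trans with (sum_n a n); [|lra].
  rewrite sum_n_Reals; destruct n as [|n]; simpl; [lra|].
  assert (0 <= sum_f_R0 a n) by (apply cond_pos_sum; auto); lra.
Qed.

(** If [u] is above the threshold [T], then [F u] exceeds [exp (2 / e * u)], and
    the exponent [2 / e] is chosen so that this grows like the inverse square of
    [sq_dist], as the density does.  If [u <= T], the bound [pot <= T]
    makes [sq_dist] at least [exp (c - T / e)], and the smallness of [q] brings the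
    density below [e]. *)
Lemma pot_density_le (F : R -> R) (e a c q T x y u : R) :
  0 < e -> 0 < q <= / 4 -> 0 <= c ->
  (forall t, T < t -> exp (2 / e * t) < F t) ->
  q <= exp (- (2 * T / e)) / 4 ->
  1 <= F u -> pot e a c q x y <= u ->
  4 * e * q * / sq_dist a q x y ^ 2 <= e * F u.
Proof.
  intros He Hq Hc HT HqT HF Hu.
  assert (Hs := sq_dist_ge a q x y).
  unfold pot in Hu; set (s := sq_dist a q x y) in *.
  assert (Hs2 : exp (- (2 * ln s)) = / s ^ 2).
  { rewrite exp_Ropp; f_equal; replace (2 * ln s) with (ln s + ln s) by ring.
    rewrite exp_plus, exp_ln; [ring|lra]. }
  assert (E4 : 1 <= exp (2 * c)) by (assert (E := exp_ineq1_le (2 * c)); lra).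
  assert (Hi : 0 < / s ^ 2) by (apply Rinv_0_lt_compat, pow_lt; lra).
  replace (4 * e * q * / s ^ 2) with (e * (4 * q * / s ^ 2)) by ring.
  apply Rmult_le_compat_l; [lra|].
  destruct (Rlt_le_dec T u) as [Hlt|Hle].
  - apply Rle_trans with (exp (2 / e * u)); [|apply Rlt_le, HT, Hlt].
    apply Rle_trans with (exp (2 * c + - (2 * ln s))).
    + rewrite exp_plus, Hs2; apply Rmult_le_compat_r; lra.
    + assert (Hm : 2 / e * (e * (c - ln s)) <= 2 / e * u).
      { apply Rmult_le_compat_l; [|exact Hu].
        apply Rlt_le, Rdiv_lt_0_compat; lra. }
      replace (2 / e * (e * (c - ln s))) with (2 * c + - (2 * ln s)) in Hm by (field; lra).
      destruct Hm as [Hm|Hm]; [left; apply exp_increasing, Hm|rewrite Hm; lra].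
  - apply Rle_trans with 1; [|exact HF].
    rewrite <- Hs2.
    apply Rle_trans with (exp (- (2 * T / e)) * exp (- (2 * ln s))).
    + apply Rmult_le_compat_r; [apply Rlt_le, exp_pos|lra].
    + rewrite <- exp_plus, <- exp_0.
      assert (Hm : 2 / e * (e * (c - ln s)) <= 2 / e * T).
      { apply Rmult_le_compat_l; [|lra].
        apply Rlt_le, Rdiv_lt_0_compat; lra. }
      replace (2 / e * (e * (c - ln s))) with (2 * c + - (2 * ln s)) in Hm by (field; lra).
      replace (2 / e * T) with (2 * T / e) in Hm by (field; lra).
      assert (Hm' : - (2 * T / e) + - (2 * ln s) <= 0) by lra.
      destruct Hm' as [Hm'|Hm']; [left; apply exp_increasing, Hm'|rewrite Hm'; lra].
Qed.

(** Superharmonic functions on the punctured disk can be as large as desired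
    along a sequence tending to the origin while their Laplacian obeys the
    nonlinear bound. *)
Lemma exists_large_superharmonic (F : R -> R) (h : nat -> R) :
  (forall K, exists T, forall t, T < t -> exp (K * t) < F t) ->
  (forall n, 0 <= h n) ->
  exists u : R -> R -> R,
    C2_on punctured_unit_disk u /\
    (forall x y, punctured_unit_disk x y ->
       0 < u x y /\ 0 <= - laplacian u x y <= F (u x y)) /\
    forall n, h n <= u (dyadic n) 0.
Proof.
  intros HF Hh.
  assert (HF' : forall K, exists T, 0 <= T /\ forall t, T < t -> exp (K * t) < F t).
  { intros K; destruct (HF K) as [T HT]; exists (Rmax T 0); split; [apply Rmax_r|].
    intros t Ht; apply HT; eapply Rle_lt_trans; [apply Rmax_l|exact Ht]. }
  destruct (HF' 0) as [T0 [HT0 HF0]].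
  (* On the unit disk the logarithms are at most 4, so that c - ln s_n >= T0 + 1;
     as the weights sum to 1, the whole sum is then above T0, where F > 1. *)
  set (c := T0 + 5).
  destruct (functional_choice (fun n qn => exists T, 0 < qn <= / 4 /\
     (forall t, T < t -> exp (2 / dyadic n * t) < F t) /\
     qn <= exp (- (2 * T / dyadic n)) / 4 /\
     h n <= dyadic n * (c - ln qn))) as [q Hq].
  { intros n; assert (Hd := dyadic_bounds n); specialize (Hh n).
    destruct (HF' (2 / dyadic n)) as [T [HT HFT]].
    assert (A1 : 0 <= 2 * T / dyadic n) by (apply Rle_mult_inv_pos; lra).
    assert (A2 : 0 <= h n / dyadic n) by (apply Rle_mult_inv_pos; lra).
    (* The first summand of the exponent makes the density small, the second
       one makes the value at the centre large. *)
    exists (exp (- (2 * T / dyadic n + h n / dyadic n)) / 4), T.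
    assert (P := exp_pos (- (2 * T / dyadic n + h n / dyadic n))).
    assert (Hexp : forall s t, s <= t -> exp s <= exp t).
    { intros s t [H|H]; [left; apply exp_increasing, H|rewrite H; lra]. }
    assert (L1 := Hexp (- (2 * T / dyadic n + h n / dyadic n)) 0 ltac:(lra)).
    rewrite exp_0 in L1.
    assert (L2 := Hexp (- (2 * T / dyadic n + h n / dyadic n)) (- (2 * T / dyadic n)) ltac:(lra)).
    split; [lra|split; [exact HFT|split; [lra|]]].
    unfold Rdiv at 1; rewrite ln_mult by lra.
    rewrite ln_exp, ln_Rinv by lra.
    assert (L4 : 0 <= ln 4) by (rewrite <- ln_1; apply ln_le; lra).
    apply Rle_trans with (dyadic n * (h n / dyadic n)); [right; field; lra|].
    apply Rmult_le_compat_l; unfold c; lra. }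
  assert (Hq4 : forall n, 0 < q n <= / 4) by (intros n; destruct (Hq n) as [T H]; apply H).
  destruct (pot_series_C2 c q Hq4) as [HC2 HL].
  set (w := fun n => pot (dyadic n) (dyadic n) c (q n)) in *.
  assert (Hw : forall n x y, punctured_unit_disk x y -> dyadic n * (T0 + 1) <= w n x y).
  { intros n x y Hxy; apply punctured_unit_disk_iff in Hxy.
    destruct (disk_geometry (dyadic n) (q n) x y (dyadic_bounds n) (Hq4 n) (proj2 Hxy))
      as [_ [_ G3]].
    assert (G4 := sq_dist_ge (dyadic n) (q n) x y); assert (G5 := Hq4 n).
    unfold w, pot; apply Rmult_le_compat_l; [apply Rlt_le, dyadic_bounds|].
    assert (ln (sq_dist (dyadic n) (q n) x y) <= 4); [|unfold c; lra].
    apply Rle_trans with (ln (exp 4)); [apply ln_le; [lra|]|rewrite ln_exp; lra].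
    assert (E := exp_ineq1 4 ltac:(lra)); lra. }
  assert (Hw0 : forall n x y, punctured_unit_disk x y -> 0 <= w n x y).
  { intros n x y Hxy; eapply Rle_trans; [|apply Hw, Hxy].
    apply Rmult_le_pos; [apply Rlt_le, dyadic_bounds|lra]. }
  assert (Hterm : forall n x y, punctured_unit_disk x y -> w n x y <= Series2 w x y).
  { intros n x y Hxy; apply (term_le_Series (fun n => w n x y)).
    - intros k; apply Hw0, Hxy.
    - apply HL, Hxy. }
  exists (Series2 w); split; [exact HC2|split].
  - intros x y Hxy.
    destruct (HL x y Hxy) as [Hex Hlap].
    assert (Hlow : T0 + 1 <= Series2 w x y).
    { rewrite <- (is_series_unique _ _ (is_series_dyadic_mult (T0 + 1))).
      apply Series_le; [|exact Hex].
      intros n; split; [|apply Hw, Hxy].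
      apply Rmult_le_pos; [apply Rlt_le, dyadic_bounds|lra]. }
    assert (HF1 : 1 <= F (Series2 w x y)).
    { left; rewrite <- exp_0, <- (Rmult_0_l (Series2 w x y)); apply HF0; lra. }
    split; [lra|].
    assert (Hterms : forall n, 0 <= 4 * dyadic n * q n * / sq_dist (dyadic n) (q n) x y ^ 2
       <= dyadic n * F (Series2 w x y)).
    { intros n; assert (Hd := dyadic_bounds n); assert (Hqn := Hq4 n).
      assert (Hs := sq_dist_ge (dyadic n) (q n) x y).
      split.
      - apply Rlt_le, Rmult_lt_0_compat; [nra|apply Rinv_0_lt_compat, pow_lt; lra].
      - destruct (Hq n) as [T [_ [H1 [H2 _]]]].
        apply pot_density_le with (c := c) (T := T); auto; try (unfold c; lra).
        apply Hterm, Hxy. }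
    rewrite <- (is_series_unique _ _ Hlap); split.
    + eapply Rle_trans; [apply (Hterms 0%nat)|].
      apply (term_le_Series (fun n => 4 * dyadic n * q n * / sq_dist (dyadic n) (q n) x y ^ 2)).
      * intros n; apply Hterms.
      * eexists; exact Hlap.
    + rewrite <- (is_series_unique _ _ (is_series_dyadic_mult (F (Series2 w x y)))).
      apply Series_le; [exact Hterms|].
      eexists; apply is_series_dyadic_mult.
  - intros n; assert (Hd := dyadic_bounds n).
    apply Rle_trans with (w n (dyadic n) 0).
    + destruct (Hq n) as [T H].
      unfold w, pot, sq_dist.
      replace ((dyadic n - dyadic n) ^ 2 + 0 ^ 2 + q n) with (q n) by ring.
      apply H.
    + apply Hterm, punctured_unit_disk_iff; nra.
Qed.

(** * Unbounded solutions of the system *)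

Lemma superexponential (f : R -> R) :
  (forall t, 0 < t -> 0 < f t) -> is_lim (fun t => ln (f t) / t) p_infty p_infty ->
  forall K, exists T, forall t, T < t -> exp (K * t) < f t.
Proof.
  intros Hf Hl K.
  apply is_lim_spec in Hl; destruct (Hl K) as [T HT].
  exists (Rmax T 0); intros t Ht.
  assert (H1 := Rle_lt_trans _ _ _ (Rmax_l T 0) Ht).
  assert (H2 := Rle_lt_trans _ _ _ (Rmax_r T 0) Ht).
  rewrite <- (exp_ln (f t)) by auto.
  apply exp_increasing.
  apply Rmult_lt_reg_r with (/ t); [apply Rinv_0_lt_compat, H2|].
  rewrite Rmult_assoc, Rinv_r, Rmult_1_r by lra.
  apply HT, H1.
Qed.

Lemma not_bigO_of_large (u : R -> R -> R) (h : R -> R) :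
  (forall r, 0 < r < 1 -> 0 < h r) ->
  (forall n, (INR n + 1) * h (dyadic n) <= u (dyadic n) 0) ->
  ~ bigO_at_origin u (fun x y => h (enorm x y)).
Proof.
  intros Hh Hu [C [delta [Hd HO]]].
  destruct (dyadic_lim delta Hd) as [N HN].
  destruct (nfloor_ex (Rmax C 0) (Rmax_r C 0)) as [k [_ Hk]].
  set (n := (N + k)%nat).
  assert (Hn := dyadic_bounds n).
  assert (En : enorm (dyadic n) 0 = dyadic n).
  { unfold enorm; replace (dyadic n ^ 2 + 0 ^ 2) with (Rsqr (dyadic n)) by (unfold Rsqr; ring).
    apply sqrt_Rsqr; lra. }
  assert (Hdn : dyadic n < delta) by (apply HN; unfold n; lia).
  specialize (HO (dyadic n) 0); rewrite En in HO.
  specialize (HO (conj (proj1 Hn) Hdn)).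
  assert (Hhn : 0 < h (dyadic n)) by (apply Hh; lra).
  rewrite (Rabs_pos_eq (h _)) in HO by lra.
  assert (HA := Rle_abs (u (dyadic n) 0)).
  specialize (Hu n).
  assert (Hkn : INR k <= INR n) by (apply le_INR; unfold n; lia).
  assert (HC := Rmax_l C 0).
  assert (C * h (dyadic n) < (INR n + 1) * h (dyadic n)); [|lra].
  apply Rmult_lt_compat_r; lra.
Qed.

Theorem theorem2p2 (f g h : R -> R)
  (f_pos : forall t : R, 0 < t -> 0 < f t)
  (g_pos : forall t : R, 0 < t -> 0 < g t)
  (f_cont : continuous_on (fun t : R => 0 < t) f)
  (g_cont : continuous_on (fun t : R => 0 < t) g)
  (f_lim : is_lim (fun t : R => ln (f t) / t) p_infty p_infty)
  (g_lim : is_lim (fun t : R => ln (g t) / t) p_infty p_infty)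
  (h_pos : forall r : R, 0 < r < 1 -> 0 < h r)
  (h_cont : continuous_on (fun r : R => 0 < r < 1) h)
  (h_lim : filterlim h (at_right 0) (Rbar_locally p_infty)) :
  exists u v : R -> R -> R,
    C2_on punctured_unit_disk u /\
    C2_on punctured_unit_disk v /\
    (forall x1 x2 : R, punctured_unit_disk x1 x2 ->
      0 < u x1 x2 /\ 0 < v x1 x2 /\
      0 <= - laplacian u x1 x2 <= f (v x1 x2) /\
      0 <= - laplacian v x1 x2 <= g (u x1 x2)) /\
    ~ bigO_at_origin u (fun x1 x2 : R => h (enorm x1 x2)) /\
    ~ bigO_at_origin v (fun x1 x2 : R => h (enorm x1 x2)).
Proof.
  destruct (exists_large_superharmonic (fun t => Rmin (f t) (g t))
    (fun n => (INR n + 1) * h (dyadic n))) as [u [HC2 [Hu Hlarge]]].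
  - intros K.
    destruct (superexponential f f_pos f_lim K) as [T1 H1].
    destruct (superexponential g g_pos g_lim K) as [T2 H2].
    exists (Rmax T1 T2); intros t Ht; apply Rmin_glb_lt.
    + apply H1, (Rle_lt_trans _ _ _ (Rmax_l T1 T2) Ht).
    + apply H2, (Rle_lt_trans _ _ _ (Rmax_r T1 T2) Ht).
  - intros n; assert (Hd := dyadic_bounds n); assert (Hn := pos_INR n).
    apply Rmult_le_pos; [lra|apply Rlt_le, h_pos; lra].
  - assert (HO := not_bigO_of_large u h h_pos Hlarge).
    exists u, u; do 2 (split; [exact HC2|]); split; [|split; exact HO].
    intros x1 x2 Hx; destruct (Hu x1 x2 Hx) as [Hpos [Hl1 Hl2]].
    assert (Mf := Rmin_l (f (u x1 x2)) (g (u x1 x2))).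
    assert (Mg := Rmin_r (f (u x1 x2)) (g (u x1 x2))).
    repeat split; lra.
Qed.
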